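(* $V_3=36.9199911$, and this value is attained by the cosine polynomial $f(\phi)=4(\cos\phi+1)(\cos\phi+\alpha_0)^2\in C_3$ with $\alpha_0= 0.4384345$.
   Context: For an integer $n\ge 2$, $C_n$ denotes the set of real cosine polynomials $f(\phi)=\sum_{k=0}^{n} a_k\cos(k\phi)$ such that (i) all coefficients $a_0,\dots,a_n$ are real and nonnegative, (ii) $a_1>a_0>0$, and (iii) $f(\phi)\ge 0$ for all real $\phi$. For $f\in C_n$ put $v(f)=\dfrac{f(0)-a_0}{(\sqrt{a_1}-\sqrt{a_0})^2}$, and $V_n=\inf_{f\in C_n} v(f)$. Numerical constants are decimal values as given in the paper, to seven decimal places. *)

(* Defs.v *)
From Stdlib Require Import Reals.
From Coquelicot Require Import Coquelicot.
Open Scope R_scope.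

(* A cosine polynomial of degree at most [n] is given by its coefficients
   [a 0, ..., a n], which it determines uniquely as a function of [phi];
   the values [a k] with [k > n] are irrelevant everywhere below. *)
Definition cos_poly (n : nat) (a : nat -> R) (phi : R) : R :=
  sum_f_R0 (fun k => a k * cos (INR k * phi)) n.

Definition in_C (n : nat) (a : nat -> R) : Prop :=
  (forall k : nat, (k <= n)%nat -> 0 <= a k) /\
  (a 0%nat < a 1%nat /\ 0 < a 0%nat) /\
  (forall phi : R, 0 <= cos_poly n a phi).

Definition v (n : nat) (a : nat -> R) : R :=
  (cos_poly n a 0 - a 0%nat) / (sqrt (a 1%nat) - sqrt (a 0%nat)) ^ 2.

Definition V (n : nat) : Rbar :=
  Glb_Rbar (fun y : R => exists a : nat -> R, in_C n a /\ y = v n a).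

(* [d] is the decimal value of [x] rounded to seven places. *)
Definition eq_7_decimals (x d : R) : Prop := Rabs (x - d) < 5 / 10 ^ 8.

(* Main.v *)
Require Import Defs.
From Stdlib Require Import Reals Lra.
From Coquelicot Require Import Coquelicot.
Open Scope R_scope.

(** Write [x = cos phi]. The polynomial [4 (x + 1) (x + al)^2] has coefficients
    [a0 = 4 al^2 + 4 al + 2], [a1 = 4 al^2 + 8 al + 3], [a2 = 4 al + 2],
    [a3 = 1], and it vanishes exactly at [x = -1] and [x = -al]. By linear
    programming duality, a suitable nonnegative combination of the conditions
    [f >= 0] at these two points, in which [a2] and [a3] get equal weights,
    shows that it minimizes [a2 + a3] among all [f] in [C_3] with the same
    [a0] and [a1], for [al] in [0.32, 0.66]. Since the ratio [a1 / a0] of this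
    family is continuous in [al], [v f] is at least the value of [v] on the
    family whenever [a1 / a0] lies between the ratios at [al = 0.32] and
    [al = 0.66]; outside, the duality inequality of the nearer endpoint already
    gives [v f >= 36.93]. What remains is to minimize a function of [al] on
    [0.32, 0.66]. Its minimizer is interior, hence a root of an explicit sextic,
    which locates it. *)

(** * The extremal family of cubic cosine polynomials *)

Definition A0 (al : R) : R := 4 * al ^ 2 + 4 * al + 2.
Definition A1 (al : R) : R := 4 * al ^ 2 + 8 * al + 3.

Definition coeffs (al : R) (k : nat) : R :=
  match k with
  | 0%nat => A0 al
  | 1%nat => A1 al
  | 2%nat => 4 * al + 2
  | _ => 1
  end.

Definition numer (al : R) : R := 4 * al ^ 2 + 12 * al + 6.
Definition gap (al : R) : R := sqrt (A1 al) - sqrt (A0 al).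
Definition profile (al : R) : R := numer al / gap al ^ 2.

Lemma cos_poly_3 (a : nat -> R) (phi : R) :
  cos_poly 3 a phi =
  a 0%nat + a 1%nat * cos phi + a 2%nat * (2 * cos phi ^ 2 - 1)
  + a 3%nat * (4 * cos phi ^ 3 - 3 * cos phi).
Proof.
  unfold cos_poly; cbn [sum_f_R0].
  replace (INR 0 * phi) with 0 by (simpl; ring).
  replace (INR 1 * phi) with phi by (simpl; ring).
  replace (INR 2 * phi) with (2 * phi) by (simpl; ring).
  replace (INR 3 * phi) with (2 * phi + phi) by (simpl; ring).
  rewrite cos_plus, cos_0, sin_2a, cos_2a_cos.
  replace (2 * sin phi * cos phi * sin phi)
    with (2 * cos phi * (sin phi)²) by (unfold Rsqr; ring).
  rewrite sin2; unfold Rsqr; ring.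
Qed.

Lemma v_3 (a : nat -> R) :
  v 3 a = (a 1%nat + a 2%nat + a 3%nat) / (sqrt (a 1%nat) - sqrt (a 0%nat)) ^ 2.
Proof. unfold v; rewrite cos_poly_3, cos_0; f_equal; ring. Qed.

Lemma in_C_3_eval (a : nat -> R) (x : R) :
  in_C 3 a -> -1 <= x <= 1 ->
  0 <= a 0%nat + a 1%nat * x + a 2%nat * (2 * x ^ 2 - 1)
       + a 3%nat * (4 * x ^ 3 - 3 * x).
Proof.
  intros [_ [_ Hf]] Hx.
  specialize (Hf (acos x)); rewrite cos_poly_3, cos_acos in Hf; lra.
Qed.

Lemma cos_poly_coeffs (al phi : R) :
  cos_poly 3 (coeffs al) phi = 4 * (cos phi + 1) * (cos phi + al) ^ 2.
Proof. rewrite cos_poly_3; unfold coeffs, A0, A1; ring. Qed.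

Lemma coeffs_in_C (al : R) : 0 < al -> in_C 3 (coeffs al).
Proof.
  intros Hal; repeat split.
  - intros k _; destruct k as [|[|[|k]]]; simpl; unfold A0, A1; nra.
  - simpl; unfold A0, A1; lra.
  - simpl; unfold A0; nra.
  - intros phi; rewrite cos_poly_coeffs.
    apply Rmult_le_pos; [|apply pow2_ge_0].
    pose proof (COS_bound phi); lra.
Qed.

Lemma v_coeffs (al : R) : v 3 (coeffs al) = profile al.
Proof.
  rewrite v_3; unfold profile, numer, gap; simpl coeffs; f_equal.
  unfold A1; ring.
Qed.

Lemma gap_pos (al : R) : 0 < al -> 0 < gap al.
Proof.
  intros Hal; unfold gap, A0, A1; apply Rlt_0_minus, sqrt_lt_1; nra.
Qed.

(** * Lower bounds by linear programming duality *)

(** [cutD] is the common coefficient of [a2] and [a3] in the dual combination, and [cutL] the weight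
    at [x = -1] that produces it. *)
Definition cutD (al : R) : R := (1 - al) * (4 * al ^ 2 + 2 * al - 1).
Definition cutL (al : R) : R := cutD al + 2 * (1 - 2 * al ^ 2).

(* The sum of [cutL al * f] at [x = -1] and [2 * f] at [x = -al]; the weights
   are chosen to make the coefficients of [a2] and [a3] agree. *)
Lemma dual_cut (a : nat -> R) (al : R) :
  in_C 3 a -> 0.32 <= al <= 0.66 ->
  (cutL al + 2 * al) * a 1%nat - (cutL al + 2) * a 0%nat
  <= cutD al * (a 2%nat + a 3%nat).
Proof.
  intros Ha Hal.
  assert (HL : 0 <= cutL al) by (unfold cutL, cutD; nra).
  pose proof (in_C_3_eval a (-1) Ha ltac:(lra)) as H1.
  pose proof (in_C_3_eval a (- al) Ha ltac:(lra)) as H2.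
  apply (Rmult_le_compat_l _ _ _ HL) in H1.
  unfold cutL, cutD in *; lra.
Qed.

(** The quadratic factor changes sign at [(sqrt 5 - 1) / 4], about 0.309, just left of the
    interval. *)
Lemma cutD_pos (al : R) : 0.32 <= al <= 0.66 -> 0 < cutD al.
Proof. intros Hal; unfold cutD; apply Rmult_lt_0_compat; nra. Qed.

Lemma profile_le_v (a : nat -> R) (al : R) :
  in_C 3 a -> 0.32 <= al <= 0.66 ->
  a 1%nat * A0 al = a 0%nat * A1 al -> profile al <= v 3 a.
Proof.
  intros Ha Hal Hr.
  pose proof (cutD_pos al Hal) as HD.
  assert (HA0 : 0 < A0 al) by (unfold A0; nra).
  pose proof (dual_cut a al Ha Hal) as Hc.
  destruct Ha as [_ [[H10 H0] _]].
  set (k := a 0%nat / A0 al).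
  assert (Hk : 0 < k) by (apply Rdiv_lt_0_compat; assumption).
  assert (E0 : a 0%nat = k * A0 al) by (unfold k; field; lra).
  assert (E1 : a 1%nat = k * A1 al)
    by (apply Rmult_eq_reg_r with (A0 al); [rewrite Hr; unfold k; field|]; lra).
  (* The family member vanishes at both points behind [dual_cut], so it attains equality there;
     scaling it by [k] matches [a0] and [a1]. *)
  assert (H23 : k * (4 * al + 3) <= a 2%nat + a 3%nat).
  { apply Rmult_le_reg_l with (1 := HD).
    eapply Rle_trans; [|exact Hc]; rewrite E0, E1.
    apply Req_le; unfold cutL, cutD, A0, A1; ring. }
  rewrite v_3, E0, E1, !sqrt_mult by (unfold A0, A1; nra).
  pose proof (gap_pos al ltac:(lra)) as Hg.
  replace ((sqrt k * sqrt (A1 al) - sqrt k * sqrt (A0 al)) ^ 2)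
    with (k * gap al ^ 2).
  2:{ rewrite <- (sqrt_sqrt k) at 1 by lra; unfold gap; ring. }
  replace (profile al) with (k * numer al / (k * gap al ^ 2))
    by (unfold profile; field; lra).
  apply Rmult_le_compat_r.
  - left; apply Rinv_0_lt_compat, Rmult_lt_0_compat, pow_lt; assumption.
  - unfold numer; unfold A1 in *; lra.
Qed.

Lemma v_3_ge (a : nat -> R) (c : R) :
  in_C 3 a ->
  c * (sqrt (a 1%nat) - sqrt (a 0%nat)) ^ 2 <= a 1%nat + a 2%nat + a 3%nat ->
  c <= v 3 a.
Proof.
  intros [_ [[H10 H0] _]] H; rewrite v_3.
  apply Rle_div_r; [|exact H].
  apply Rlt_gt, pow_lt, Rlt_0_minus, sqrt_lt_1; lra.
Qed.

Lemma v_ge_large_ratio (a : nat -> R) :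
  in_C 3 a -> a 0%nat * A1 0.32 <= a 1%nat * A0 0.32 -> 36.93 <= v 3 a.
Proof.
  intros Ha Hr; apply v_3_ge; [exact Ha|].
  pose proof (dual_cut a 0.32 Ha ltac:(lra)) as Hc.
  destruct Ha as [_ [[H10 H0] _]].
  pose proof (sqrt_lt_R0 (a 0%nat) H0) as Hy.
  pose proof (sqrt_lt_1 (a 0%nat) (a 1%nat) ltac:(lra) ltac:(lra) H10) as Hxy.
  pose proof (sqrt_sqrt (a 0%nat) ltac:(lra)) as Ey.
  pose proof (sqrt_sqrt (a 1%nat) ltac:(lra)) as Ex.
  set (x := sqrt (a 1%nat)) in *; set (y := sqrt (a 0%nat)) in *.
  rewrite <- Ex, <- Ey in *.
  unfold cutL, cutD, A0, A1 in *.
  (* 1.27198 is [sqrt (A1 0.32 / A0 0.32)] rounded down. The cut reduces the goal to a quadratic in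
     [x / y] that is positive from there on. *)
  assert (1.27198 * y <= x) by nra.
  nra.
Qed.

Lemma v_ge_small_ratio (a : nat -> R) :
  in_C 3 a -> a 1%nat * A0 0.66 <= a 0%nat * A1 0.66 -> 36.93 <= v 3 a.
Proof.
  intros Ha Hr; apply v_3_ge; [exact Ha|].
  pose proof (dual_cut a 0.66 Ha ltac:(lra)) as Hc.
  destruct Ha as [_ [[H10 H0] _]].
  pose proof (sqrt_lt_R0 (a 0%nat) H0) as Hy.
  pose proof (sqrt_lt_1 (a 0%nat) (a 1%nat) ltac:(lra) ltac:(lra) H10) as Hxy.
  pose proof (sqrt_sqrt (a 0%nat) ltac:(lra)) as Ey.
  pose proof (sqrt_sqrt (a 1%nat) ltac:(lra)) as Ex.
  set (x := sqrt (a 1%nat)) in *; set (y := sqrt (a 0%nat)) in *.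
  rewrite <- Ex, <- Ey in *.
  unfold cutL, cutD, A0, A1 in *.
  (* 1.25313 is [sqrt (A1 0.66 / A0 0.66)] rounded up. Here the quadratic in [x / y] is concave and
     positive at both 1 and 1.25313. *)
  assert (x <= 1.25313 * y) by nra.
  nra.
Qed.

Lemma v_3_lower_bound (a : nat -> R) (c : R) :
  in_C 3 a -> c <= 36.93 ->
  (forall al : R, 0.32 <= al <= 0.66 -> c <= profile al) -> c <= v 3 a.
Proof.
  intros Ha Hc Hp.
  destruct (Rle_lt_dec (a 0%nat * A1 0.32) (a 1%nat * A0 0.32)) as [H1|H1].
  { apply Rle_trans with (1 := Hc), v_ge_large_ratio; assumption. }
  destruct (Rle_lt_dec (a 1%nat * A0 0.66) (a 0%nat * A1 0.66)) as [H2|H2].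
  { apply Rle_trans with (1 := Hc), v_ge_small_ratio; assumption. }
  set (g := fun al => a 1%nat * A0 al - a 0%nat * A1 al).
  destruct (IVT g 0.32 0.66) as [al [Hal Hg]].
  - unfold g, A0, A1; reg.
  - lra.
  - unfold g; lra.
  - unfold g; lra.
  - apply Rle_trans with (1 := Hp al Hal), profile_le_v; trivial.
    unfold g in Hg; lra.
Qed.

(** * Critical points of the profile *)

Definition profile' (al : R) : R :=
  ((8 * al + 12) * gap al
   - 2 * numer al * ((4 * al + 4) / sqrt (A1 al) - (4 * al + 2) / sqrt (A0 al)))
  / gap al ^ 3.

Lemma is_derive_profile (al : R) : 0 < al -> is_derive profile al (profile' al).
Proof.
  intros Hal.
  pose proof (gap_pos al Hal) as Hg.
  assert (H0 : 0 < A0 al) by (unfold A0; nra).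
  assert (H1 : 0 < A1 al) by (unfold A1; nra).
  pose proof (sqrt_lt_R0 _ H0) as HS0; pose proof (sqrt_lt_R0 _ H1) as HS1.
  unfold profile, profile', numer, gap, A0, A1 in *.
  auto_derive.
  - repeat split; try lra.
    apply Rgt_not_eq; simpl in *; nra.
  - change (al * (al * 1)) with (al ^ 2).
    field; simpl in *; repeat split; lra.
Qed.

Definition K (al : R) : R := 4 * al ^ 2 + 6 * al + 3.

(** Clearing denominators and replacing the squares of the roots by [A0] and [A1] leaves a relation
    linear in the two roots; the cubic terms of its coefficients cancel. *)
Lemma critical_eq (al : R) :
  0 < al -> profile' al = 0 ->
  sqrt (A0 al) * K al = sqrt (A1 al) * (8 * al * (al + 1)).
Proof.
  intros Hal Hd.
  pose proof (gap_pos al Hal) as Hg.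
  assert (H0 : 0 < A0 al) by (unfold A0; nra).
  assert (H1 : 0 < A1 al) by (unfold A1; nra).
  pose proof (sqrt_lt_R0 _ H0) as HS0; pose proof (sqrt_lt_R0 _ H1) as HS1.
  pose proof (pow2_sqrt (A0 al) ltac:(lra)) as E0.
  pose proof (pow2_sqrt (A1 al) ltac:(lra)) as E1.
  unfold profile', gap in *.
  set (q := sqrt (A0 al)) in *; set (p := sqrt (A1 al)) in *.
  assert (Hn : (8 * al + 12) * (p ^ 2 * q - p * q ^ 2)
               - 2 * numer al * ((4 * al + 4) * q - (4 * al + 2) * p) = 0).
  { transitivity (0 * (p * q * (p - q) ^ 3)); [|ring].
    rewrite <- Hd; field; repeat split; lra. }
  rewrite E0, E1 in Hn; unfold numer, K, A0, A1 in *; lra.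
Qed.

Definition sextic (x : R) : R :=
  96 * x ^ 6 + 384 * x ^ 5 + 504 * x ^ 4 + 208 * x ^ 3
  - 54 * x ^ 2 - 54 * x - 9.

Lemma sextic_critical (al : R) :
  0 < al -> profile' al = 0 -> sextic al = 0.
Proof.
  intros Hal Hd.
  pose proof (critical_eq al Hal Hd) as E.
  assert (H0 : 0 < A0 al) by (unfold A0; nra).
  assert (H1 : 0 < A1 al) by (unfold A1; nra).
  apply (f_equal (fun t => t ^ 2)) in E.
  rewrite !Rpow_mult_distr, !pow2_sqrt in E by lra.
  unfold sextic, K, A0, A1 in *; lra.
Qed.

Lemma sextic_increasing (x y : R) :
  0.32 <= x -> x < y -> sextic x < sextic y.
Proof.
  intros Hx Hxy.
  apply Rlt_0_minus.
  replace (sextic y - sextic x) with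
    ((y - x) *
     (96 * (y ^ 5 + y ^ 4 * x + y ^ 3 * x ^ 2 + y ^ 2 * x ^ 3 + y * x ^ 4 + x ^ 5)
      + 384 * (y ^ 4 + y ^ 3 * x + y ^ 2 * x ^ 2 + y * x ^ 3 + x ^ 4)
      + 504 * (y ^ 3 + y ^ 2 * x + y * x ^ 2 + x ^ 3)
      + 208 * (y ^ 2 + y * x + x ^ 2) - 54 * (y + x) - 54))
    by (unfold sextic; ring).
  apply Rmult_lt_0_compat; [lra|].
  assert (P : forall i j, 0.32 ^ i * 0.32 ^ j <= y ^ i * x ^ j).
  { intros i j; apply Rmult_le_compat; try apply pow_le; try apply pow_incr; lra. }
  pose proof (P 5 0)%nat; pose proof (P 4 1)%nat; pose proof (P 3 2)%nat.
  pose proof (P 2 3)%nat; pose proof (P 1 4)%nat; pose proof (P 0 5)%nat.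
  pose proof (P 4 0)%nat; pose proof (P 3 1)%nat; pose proof (P 2 2)%nat.
  pose proof (P 1 3)%nat; pose proof (P 0 4)%nat.
  pose proof (P 3 0)%nat; pose proof (P 2 1)%nat; pose proof (P 1 2)%nat.
  pose proof (P 0 3)%nat.
  (* These let the quadratic terms dominate [54 * (y + x)]; the bounds from [P] outweigh the
     constant 54. *)
  assert (0.32 * y <= y ^ 2) by nra.
  assert (0.32 * y <= y * x) by nra.
  assert (0.32 * x <= x ^ 2) by nra.
  lra.
Qed.

(** Seven places would not suffice: the root-free formula for the critical value has slope about 400
    in [al]. *)
Lemma critical_bounds (al : R) :
  0.32 <= al -> profile' al = 0 -> 0.43843450290 < al < 0.43843450291.
Proof.
  intros Hal Hd.
  pose proof (sextic_critical al ltac:(lra) Hd) as Hs.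
  split; apply Rnot_le_lt; intros [H|H].
  2,4: subst al; unfold sextic in Hs; lra.
  all: apply sextic_increasing in H; [|lra]; rewrite Hs in H.
  all: unfold sextic in H; lra.
Qed.

(* The critical equation eliminates both square roots from [profile al]. *)
Lemma profile_critical (al : R) :
  0.32 <= al -> profile' al = 0 -> eq_7_decimals (profile al) 36.9199911.
Proof.
  intros Hal Hd.
  pose proof (critical_bounds al Hal Hd) as Hb.
  pose proof (critical_eq al ltac:(lra) Hd) as E.
  pose proof (gap_pos al ltac:(lra)) as Hg.
  assert (H1 : 0 < A1 al) by (unfold A1; nra).
  pose proof (pow2_sqrt (A1 al) ltac:(lra)) as E1.
  assert (HK : 0 < K al) by (unfold K; nra).
  (* [M] is [K al - 8 * al * (al + 1)], the factor left when [critical_eq] eliminates [sqrt (A0 al)]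
     from the gap. *)
  set (M := 3 - 2 * al - 4 * al ^ 2).
  assert (Eg : gap al * K al = sqrt (A1 al) * M).
  { unfold gap; rewrite Rmult_minus_distr_r, E; unfold K, M; ring. }
  assert (HM : 0 < M) by (unfold M; nra).
  assert (Ep : profile al = numer al * K al ^ 2 / (A1 al * M ^ 2)).
  { rewrite <- E1, <- Rpow_mult_distr, <- Eg; unfold profile; field; lra. }
  assert (HAM : 0 < A1 al * M ^ 2)
    by (apply Rmult_lt_0_compat; [|apply pow_lt]; assumption).
  unfold eq_7_decimals; rewrite Ep; apply Rabs_def1.
  - apply Rlt_minus_l, Rlt_div_l; [exact HAM|].
    unfold numer, K, A1, M in *; nra.
  - apply Rlt_minus_r, Rlt_div_r; [exact HAM|].
    unfold numer, K, A1, M in *; nra.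
Qed.

(** * Numerical comparison of profile values *)

Lemma profile_lt (al c g : R) :
  0 < g -> g <= gap al -> numer al < c * g ^ 2 -> 0 <= c -> profile al < c.
Proof.
  intros Hg Hgap Hn Hc; unfold profile.
  apply Rlt_div_l; [apply pow_lt; lra|].
  apply Rlt_le_trans with (1 := Hn), Rmult_le_compat_l, pow_incr; lra.
Qed.

Lemma lt_profile (al c g : R) :
  0 < gap al -> gap al <= g -> c * g ^ 2 < numer al -> 0 <= c -> c < profile al.
Proof.
  intros Hg Hgap Hn Hc; unfold profile.
  apply Rlt_div_r; [apply pow_lt; lra|].
  apply Rle_lt_trans with (2 := Hn), Rmult_le_compat_l, pow_incr; lra.
Qed.

Lemma sqrt_between (x l u : R) :
  0 <= l -> 0 <= u -> l ^ 2 <= x <= u ^ 2 -> l <= sqrt x <= u.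
Proof.
  intros Hl Hu [H1 H2]; split.
  - rewrite <- (sqrt_pow2 l Hl); apply sqrt_le_1_alt; exact H1.
  - rewrite <- (sqrt_pow2 u Hu); apply sqrt_le_1_alt; exact H2.
Qed.

(** A test point near the minimizer: it puts the minimum below both endpoint values and below the
    bound 36.93 for the outer ratios. *)
Lemma profile_at_044 : profile 0.44 < 36.93.
Proof.
  pose proof (sqrt_between (A1 0.44) 2.70081 2.70082
                ltac:(lra) ltac:(lra) ltac:(unfold A1; lra)).
  pose proof (sqrt_between (A0 0.44) 2.12941 2.12942
                ltac:(lra) ltac:(lra) ltac:(unfold A0; lra)).
  apply profile_lt with 0.57139; unfold gap, numer; lra.
Qed.

Lemma profile_at_032 : 36.93 < profile 0.32.
Proof.
  pose proof (sqrt_between (A1 0.32) 2.443 2.444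
                ltac:(lra) ltac:(lra) ltac:(unfold A1; lra)).
  pose proof (sqrt_between (A0 0.32) 1.920 1.921
                ltac:(lra) ltac:(lra) ltac:(unfold A0; lra)).
  apply lt_profile with 0.524; unfold gap, numer; lra.
Qed.

Lemma profile_at_066 : 36.93 < profile 0.66.
Proof.
  pose proof (sqrt_between (A1 0.66) 3.165 3.166
                ltac:(lra) ltac:(lra) ltac:(unfold A1; lra)).
  pose proof (sqrt_between (A0 0.66) 2.526 2.527
                ltac:(lra) ltac:(lra) ltac:(unfold A0; lra)).
  apply lt_profile with 0.64; unfold gap, numer; lra.
Qed.

Theorem theorem2p13 :
  exists (V3 alpha0 : R) (a : nat -> R),
    V 3 = Finite V3 /\
    eq_7_decimals V3 36.9199911 /\
    eq_7_decimals alpha0 0.4384345 /\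
    (forall phi : R,
       cos_poly 3 a phi = 4 * (cos phi + 1) * (cos phi + alpha0) ^ 2) /\
    in_C 3 a /\
    v 3 a = V3.
Proof.
  destruct (continuity_ab_min profile 0.32 0.66) as [al [Hmin Hal]]; [lra| |].
  { intros c Hc; apply derivable_continuous_pt, ex_derive_Reals_0.
    exists (profile' c); apply is_derive_profile; lra. }
  pose proof profile_at_044; pose proof profile_at_032; pose proof profile_at_066.
  pose proof (Hmin 0.44 ltac:(lra)) as Hmin_mid.
  assert (Hint : 0.32 < al < 0.66).
  { split; apply Rnot_le_lt; intros Hx.
    - replace al with 0.32 in Hmin_mid by lra; lra.
    - replace al with 0.66 in Hmin_mid by lra; lra. }
  assert (Hd : profile' al = 0).
  { pose proof (is_derive_profile al ltac:(lra)) as D.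
    assert (pr : derivable_pt profile al)
      by (apply ex_derive_Reals_0; exists (profile' al); exact D).
    rewrite <- (is_derive_unique _ _ _ D), <- (Derive_Reals _ _ pr).
    apply (deriv_minimum profile 0.32 0.66); try lra.
    intros x Hx1 Hx2; apply Hmin; lra. }
  pose proof (coeffs_in_C al ltac:(lra)) as HC.
  exists (profile al), al, (coeffs al).
  split; [|split; [|split; [|split; [|split]]]].
  - apply is_glb_Rbar_unique; split.
    + intros y [a [Ha ->]]; simpl.
      apply v_3_lower_bound; [exact Ha|lra|exact Hmin].
    + intros b Hb; apply Hb; exists (coeffs al).
      split; [exact HC|symmetry; apply v_coeffs].
  - apply profile_critical; [lra|exact Hd].
  - pose proof (critical_bounds al ltac:(lra) Hd).
    unfold eq_7_decimals; apply Rabs_def1; lra.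
  - apply cos_poly_coeffs.
  - exact HC.
  - apply v_coeffs.
Qed.
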